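(* Let $m,n$ be coprime positive integers, let $k$ be a positive integer, and let $c$ be an integer (viewed by reduction as an element of $\mathbb{Z}_{mn}$, $\mathbb{Z}_m$ and $\mathbb{Z}_n$). Then $$\mathscr{S}_{sq}(\mathbb{Z}_{mn},c,k)=\mathscr{S}_{sq}(\mathbb{Z}_{m},c,k)\cdot\mathscr{S}_{sq}(\mathbb{Z}_{n},c,k).$$
   Context: $\mathbb{Z}_n$ is the ring of residue classes modulo $n$ and $\mathbb{Z}_n^{\ast}$ its group of units. For $c\in\mathbb{Z}_n$ and a positive integer $k$, $\mathscr{S}_{sq}(\mathbb{Z}_n,c,k)$ denotes the number of tuples $(x_1,\ldots,x_k)\in(\mathbb{Z}_n^{\ast})^k$ with $x_1^2+\cdots+x_k^2=c$ in $\mathbb{Z}_n$. *)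

(* Defs.v *)
From HB Require Import structures.
From mathcomp Require Import all_boot all_algebra.

Set Implicit Arguments.
Unset Strict Implicit.
Unset Printing Implicit Defensive.

Import GRing.Theory.
Local Open Scope ring_scope.

(* The ring Z/nZ for n > 0.  MathComp's 'Z_n is Z/2Z when n = 1, so the ring
   structure is put on an alias of 'I_n which includes the trivial ring Z/1Z,
   reusing the operations of zmodp.  The shape n.-1.+1 is the one for which
   zmodp provides 0 and 1; it makes Zmod 0 another copy of Z/1Z. *)
Definition Zmod (n : nat) : Type := 'I_n.-1.+1.

HB.instance Definition _ (n : nat) := Finite.on (Zmod n).
HB.instance Definition _ (n : nat) := GRing.Zmodule.on (Zmod n).
HB.instance Definition _ (n : nat) :=
  GRing.Zmodule_isComPzRing.Build (Zmod n)
    (@Zp_mulA n.-1.+1) (@Zp_mulC n.-1.+1) (@Zp_mul1z n.-1)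
    (@Zp_mul_addl n.-1.+1).

(* GRing.unit is only available for nontrivial rings. *)
Definition is_unit (A : finComPzRingType) (x : A) : bool :=
  [exists y : A, x * y == 1].

Definition S_sq (A : finComPzRingType) (c : A) (k : nat) : nat :=
  #|[set x : k.-tuple A |
      [forall i : 'I_k, is_unit (tnth x i)]
      && (\sum_(i < k) tnth x i ^+ 2 == c)]|.

(* Main.v *)
(* By the Chinese remainder theorem, reduction identifies Z/mnZ with
   Z/mZ x Z/nZ as rings.  Units and sums of squares in a product ring are
   computed componentwise, so the solutions over Z/mnZ correspond to pairs of
   solutions over Z/mZ and Z/nZ. *)
From HB Require Import structures.
Require Import Defs.
From mathcomp Require Import all_boot all_algebra.

Set Implicit Arguments.
Unset Strict Implicit.
Unset Printing Implicit Defensive.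

Import GRing.Theory.
Local Open Scope ring_scope.

(** Inverses of [f x] and [g x] glue through [h] to one element of [A]. Its product with [x] has the
    same two images as [1], hence equals [1] by injectivity. *)
Lemma is_unit_bij (A B C : finComPzRingType)
    (f : {rmorphism A -> B}) (g : {rmorphism A -> C}) :
  bijective (fun x => (f x, g x)) ->
  forall x, is_unit x = is_unit (f x) && is_unit (g x).
Proof.
case=> h fgK hK x; apply/existsP/andP => [[y /eqP xy1]|].
  by split; apply/existsP; [exists (f y)|exists (g y)];
     rewrite -rmorphM xy1 rmorph1.
case=> /existsP[y /eqP fxy1] /existsP[z /eqP gxz1]; exists (h (y, z)).
have [fh gh] : f (h (y, z)) = y /\ g (h (y, z)) = z by case: (hK (y, z)).
by apply/eqP/(can_inj fgK); rewrite !rmorphM fh gh fxy1 gxz1 !rmorph1.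
Qed.

Lemma S_sq_bij (A B C : finComPzRingType)
    (f : {rmorphism A -> B}) (g : {rmorphism A -> C}) (c : A) (k : nat) :
  bijective (fun x => (f x, g x)) ->
  S_sq c k = (S_sq (f c) k * S_sq (g c) k)%N.
Proof.
move=> fg_bij; have [h fgK hK] := fg_bij.
have fg_inj := can_inj fgK.
pose F (x : k.-tuple A) := (map_tuple f x, map_tuple g x).
have F_inj : injective F.
  move=> x y /pair_equal_spec[fxy gxy]; apply: eq_from_tnth => i.
  move: (congr1 (fun u => tnth u i) fxy) (congr1 (fun u => tnth u i) gxy).
  by rewrite !tnth_map => fxyi gxyi; apply: fg_inj; rewrite fxyi gxyi.
(* Since [F] is injective, it suffices that the product of the solution sets over [B] and [C] is the
   image under [F] of the one over [A]. *)
rewrite /S_sq -cardsX -[LHS](card_imset _ F_inj); apply: eq_card => -[u v].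
(* Every pair of tuples comes from [A]: glue entry by entry with [h]. *)
have [x ->] : exists x, (u, v) = F x.
  exists [tuple h (tnth u i, tnth v i) | i < k].
  by congr (_, _); apply: eq_from_tnth => i; rewrite tnth_map tnth_mktuple;
     case: (hK (tnth u i, tnth v i)).
rewrite mem_imset // !inE /=.
have sumE (D : finComPzRingType) (p : {rmorphism A -> D}) :
    \sum_(i < k) tnth (map_tuple p x) i ^+ 2 = p (\sum_(i < k) tnth x i ^+ 2).
  by rewrite rmorph_sum; apply: eq_bigr => i _; rewrite tnth_map rmorphXn.
(* Joint injectivity splits the equation in [A] into one in [B] and one in [C]. *)
rewrite !sumE -(inj_eq fg_inj) xpair_eqE andbACA; congr (_ && _).
apply/forallP/andP => [x_unit|[/forallP fx_unit /forallP gx_unit] i].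
  by split; apply/forallP => i; have := x_unit i;
     rewrite (is_unit_bij fg_bij) tnth_map => /andP[].
by rewrite (is_unit_bij fg_bij) -(tnth_map f) -(tnth_map g) fx_unit gx_unit.
Qed.

Section Reduction.
Variables (m d : nat) (m_gt0 : (0 < m)%N) (dvd_dm : (d %| m)%N).

(* The arguments m_gt0 and dvd_dm make the ring morphism instance inferable. *)
Definition Zmod_red of (0 < m)%N & (d %| m)%N := fun x : Zmod m => inZp x : Zmod d.

Local Notation red := (Zmod_red m_gt0 dvd_dm).

(** The actual moduli of [Zmod m] and [Zmod d] have the form [n.-1.+1]. Positivity of [m] matters:
    any [d] divides [0], but [Zmod 0] is trivial and has no unital map to a nontrivial ring. *)
Let dvd_pred : (d.-1.+1 %| m.-1.+1)%N.
Proof. by rewrite !prednK ?(dvdn_gt0 m_gt0). Qed.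

Lemma Zmod_red_nmod_morphism : nmod_morphism red.
Proof.
by split=> [|x y]; apply: val_inj; rewrite /= ?mod0n // modn_dvdm // modnDm.
Qed.

Lemma Zmod_red_monoid_morphism : monoid_morphism red.
Proof.
by split=> [|x y]; apply: val_inj; rewrite /= modn_dvdm // modnMm.
Qed.

HB.instance Definition _ :=
  GRing.isNmodMorphism.Build (Zmod m) (Zmod d) red Zmod_red_nmod_morphism.
HB.instance Definition _ :=
  GRing.isMonoidMorphism.Build (Zmod m) (Zmod d) red Zmod_red_monoid_morphism.

End Reduction.

Lemma card_Zmod (n : nat) : (0 < n)%N -> #|{: Zmod n}| = n.
Proof. by move=> n_gt0; rewrite card_ord prednK. Qed.

Lemma Zmod_red_bij (m n : nat) (mn_gt0 : (0 < m * n)%N) :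
  coprime m n ->
  bijective (fun x => (Zmod_red mn_gt0 (dvdn_mulr n (dvdnn m)) x,
                       Zmod_red mn_gt0 (dvdn_mull m (dvdnn n)) x)).
Proof.
move=> co_mn; have /andP[m_gt0 n_gt0] : (0 < m)%N && (0 < n)%N.
  by rewrite -muln_gt0.
(* Both sides have [m * n] elements, so the uniqueness half of the Chinese remainder theorem is
   enough. *)
apply: inj_card_bij => [x y [xy_m xy_n]|]; last first.
  by rewrite card_prod !card_Zmod.
have lt_mn (z : Zmod (m * n)) : (z < m * n)%N.
  by rewrite -[X in (_ < X)%N](prednK mn_gt0).
(* Representatives below [m * n] equal their own remainders, which turns the goal into a congruence
   modulo [m * n]. *)
apply: val_inj; rewrite /= -(modn_small (lt_mn x)) -(modn_small (lt_mn y)).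
rewrite (prednK m_gt0) in xy_m; rewrite (prednK n_gt0) in xy_n.
by apply/eqP; rewrite chinese_remainder // xy_m xy_n !eqxx.
Qed.

Theorem lemma3p1 (m n k : nat) (c : int)
    (hm : (0 < m)%N) (hn : (0 < n)%N) (hk : (0 < k)%N) (hmn : coprime m n) :
  S_sq (A := Zmod (m * n)) c%:~R k
  = (S_sq (A := Zmod m) c%:~R k * S_sq (A := Zmod n) c%:~R k)%N.
Proof.
have mn_gt0 : (0 < m * n)%N by rewrite muln_gt0 hm.
(* Ring morphisms preserve images of integers, so both reductions of [c] are again [c]. *)
by rewrite (S_sq_bij _ _ (Zmod_red_bij mn_gt0 hmn)) !rmorph_int.
Qed.
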